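(* For every integer $k \geq 6$, \[H^+(\infty,k)=\{2^{k-1}+2^i : i\in \{0,1,\dots,k-1\}\}\cup\{2^{k-1}+2^{k-5}+2^{k-6}\}.\]
   Context: Let $\mathbb{H}^n=\{0,1\}^n\subseteq\mathbb{R}^n$. For $n\geq k$, $H(n,k)$ is the set of all possible sizes $|S\cap \mathbb{H}^n|$ where $S$ ranges over $k$-dimensional linear subspaces of $\mathbb{R}^n$; equivalently, $H(n,k)=\{\,|\mathbb{H}^k\cap L^{-1}(\mathbb{H}^{n-k})| : L:\mathbb{R}^k\to\mathbb{R}^{n-k}\text{ linear}\,\}$. Let $H(\infty,k)=\bigcup_{n\geq k}H(n,k)$ and $H^+(\infty,k)=H(\infty,k)\setminus\{1,\dots,2^{k-1}\}$ (the intersection sizes larger than $2^{k-1}$). *)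

(* Defs.v *)
From HB Require Import structures.
From mathcomp Require Import all_boot all_order all_algebra.
From mathcomp Require Import reals.
Set Implicit Arguments. Unset Strict Implicit. Unset Printing Implicit Defensive.
Import Order.TTheory GRing.Theory Num.Theory.
Local Open Scope ring_scope.

(* A k-dimensional linear subspace S of R^n is represented as the row space of
   a matrix A : 'M[R]_(k,n) of rank k.  The points of the Hamming cube
   H^n = {0,1}^n are indexed by b : {ffun 'I_n -> bool}. *)
Definition cube_pt (R : realType) (n : nat) (b : {ffun 'I_n -> bool}) : 'rV[R]_n :=
  \row_i ((b i)%:R).

Definition cube_count (R : realType) (k n : nat) (A : 'M[R]_(k, n)) : nat :=
  #|[set b : {ffun 'I_n -> bool} | (cube_pt R b <= A)%MS]|.

Definition inH (R : realType) (n k m : nat) : Prop :=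
  exists A : 'M[R]_(k, n), \rank A = k /\ cube_count A = m.

Definition inHinf (R : realType) (k m : nat) : Prop :=
  exists n : nat, (k <= n)%N /\ inH R n k m.

Definition inHinf_plus (R : realType) (k m : nat) : Prop :=
  inHinf R k m /\ (2 ^ k.-1 < m)%N.

(* Main.v *)
Require Import Defs.
From mathcomp Require Import all_boot all_order all_algebra.
From mathcomp Require Import reals.
From mathcomp Require Import zify.
Set Implicit Arguments. Unset Strict Implicit. Unset Printing Implicit Defensive.
Import Order.TTheory GRing.Theory Num.Theory.
Local Open Scope ring_scope.

(** In coordinates given by a basis of columns, the intersection is the set of
    the [x] in [{0,1}^k] on which finitely many linear functionals take values
    in [{0,1}].  Call a system of affine constraints [L x + c] in [{0,1}] large
    if more than half of the cube satisfies it.  Up to a change of the shifts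
    [c], largeness survives dropping functionals and restricting to a facet of
    the cube (one of the two facets in each direction is again large).  Hence
    all coefficients are 0, 1 or -1, and only finitely many triples of
    functionals, up to permutations and sign changes of the coordinates on
    which they do not all vanish, are large; an exhaustive search lists them.
    Each of them cuts out a fraction 1, 3/4, 5/8, 9/16 or 35/64 of the cube,
    which settles the systems with at most two distinct nontrivial functionals.
    The search also shows that in a large triple of distinct functionals with
    supports of size at least 2, the first two supports meet in a core of at
    most two coordinates, with proportional columns, off which each functional
    has at most one nonzero coefficient.  With three or more functionals, the
    solution set is thus a union of two or four subcubes (one for each value on
    the core), and comparing their sizes gives [2^(k-1) + 2^i]. *)

(** * Counting subset sums *)

Section SubsetSums.
Variable G : zmodType.
Implicit Types (P : pred G) (s : seq G) (c v : G).

(* Number of the subsets of the list [s] whose sum, shifted by [c], satisfies [P]. *)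
Fixpoint cnt P s c : nat :=
  if s is v :: s' then (cnt P s' c + cnt P s' (c + v))%N else P c.

Lemma cnt_le P s c : (cnt P s c <= 2 ^ size s)%N.
Proof.
elim: s c => [|v s IH] c /=; first exact: leq_b1.
by rewrite expnS mul2n -addnn leq_add.
Qed.

(* Largeness is inherited by sublists, at the price of a change of shift. *)
Lemma cnt_cat P s t c :
  (2 ^ size (s ++ t) < (cnt P (s ++ t) c).*2)%N ->
  exists d, (2 ^ size t < (cnt P t d).*2)%N.
Proof.
elim: s c => [|v s IH] c /=; first by exists c.
move=> h; case: (ltnP (2 ^ size (s ++ t)) (cnt P (s ++ t) c).*2) => [/IH //|h1].
apply: (IH (c + v)); move: h h1; rewrite expnS; lia.
Qed.

Lemma cnt_perm P s t c : perm_eq s t -> cnt P s c = cnt P t c.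
Proof.
move=> st; have [n le_n] := ubnP (size s).
elim: n s t st le_n c => // n IH [|v s] t st le_n c.
  by move: (perm_size st); case: t {st}.
have vt : v \in t by rewrite -(perm_mem st) mem_head.
have sr : perm_eq s (rem v t).
  by rewrite -(perm_cons v); apply: perm_trans st _; exact: perm_to_rem.
rewrite /= !(IH s _ sr) //.
elim: t vt {st le_n sr IH s} c => // w t IH; rewrite inE => vt c /=.
have [-> //|wv] := eqVneq w v; move: vt; rewrite eq_sym (negPf wv) /= => vt.
by rewrite -!(IH vt) addrAC addnACA.
Qed.

Lemma cnt_nz P s c :
  cnt P s c = (cnt P [seq v <- s | v != 0%R] c * 2 ^ count (pred1 0%R) s)%N.
Proof.
elim: s c => [|v s IH] c; first by rewrite muln1.
rewrite /=; case: eqVneq => [->|_] /=; rewrite !IH ?addr0 ?add0n ?mulnDl //.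
by rewrite addnn -mul2n add1n expnS mulnCA.
Qed.

(** Replacing [v] by [- v] exchanges taking [v] and leaving it out, once the shift is increased by
    [v]. *)
Lemma cnt_sign P (h : G -> G) s : (forall v, h v = v \/ h v = - v) ->
  exists d, forall c, cnt P [seq h v | v <- s] (c + d) = cnt P s c.
Proof.
move=> hh; elim: s => [|v s [d IH]]; first by exists 0 => c; rewrite addr0.
case: (hh v) => hv; last first.
  by exists (d + v) => c /=; rewrite hv addrA addrK addrAC !IH addnC.
by exists d => c /=; rewrite hv addrAC !IH.
Qed.

(** With [v] moved to the end, a large list would make [[:: v]] large for some shift [d], so both
    [d] and [d + v] would satisfy [P]. *)
Lemma cnt_half P s v c : v \in s -> (forall d, ~~ (P d && P (d + v))) ->
  ((cnt P s c).*2 <= 2 ^ size s)%N.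
Proof.
move=> vs hP; rewrite leqNgt; apply/negP.
have ps := perm_to_rem vs.
have {}ps : perm_eq s (rem v s ++ [:: v]) by rewrite (perm_trans ps) // perm_sym perm_catC.
rewrite (perm_size ps) (cnt_perm _ _ ps) => /cnt_cat[d] /=.
by move: (hP d); case: (P d); case: (P _).
Qed.
End SubsetSums.

(** * Exhaustive search over triples of functionals *)

Section Sparse.
Variables (G : zmodType) (lt : rel G).
Implicit Types (f g : seq (G * nat)) (c v : G).

(* An association list [f] stands for the function [eval f]; repeated keys are
   added up, so that no invariant is needed for the correctness of [mrg]. *)
Fixpoint eval f c : nat :=
  if f is e :: f' then (if e.1 == c then (e.2 + eval f' c)%N else eval f' c) else 0%N.

Fixpoint mrg f : seq (G * nat) -> seq (G * nat) :=
  if f is e :: f' then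
    fix mrg_e g := if g is e' :: g' then
        if e.1 == e'.1 then (e.1, (e.2 + e'.2)%N) :: mrg f' g'
        else if lt e.1 e'.1 then e :: mrg f' g else e' :: mrg_e g'
      else f
  else id.

Lemma eval_mrg f g c : eval (mrg f g) c = (eval f c + eval g c)%N.
Proof.
elim: f g => [|e f IH] //; elim=> [|e' g IHg]; first by rewrite /= addn0.
rewrite /=; case: (e.1 =P e'.1) => [->|ne] /=.
  by rewrite IH; case: ifP => _ //; rewrite addnACA.
case: ifP => _ /=; first by rewrite IH /=; case: ifP => _; rewrite ?addnA.
rewrite IHg /=; case: ifP => _; case: ifP => _ //; lia.
Qed.

Definition shf v f := [seq (e.1 - v, e.2) | e <- f].

Lemma eval_shf v f c : eval (shf v f) c = eval f (c + v).
Proof. by elim: f => //= e f ->; rewrite subr_eq. Qed.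

Definition step v f := mrg f (shf v f).

Lemma eval_step v f c : eval (step v f) c = (eval f c + eval f (c + v))%N.
Proof. by rewrite /step eval_mrg eval_shf. Qed.

(* The test on single entries is only meaningful if the keys are distinct;
   checking that they are sorted avoids proving that [mrg] preserves this. *)
Definition big h f :=
  if sorted lt [seq e.1 | e <- f] then has (fun e => h < e.2.*2)%N f else true.

Lemma bigP h f c : transitive lt -> irreflexive lt -> (h < (eval f c).*2)%N -> big h f.
Proof.
move=> tr ir; rewrite /big; case: ifP => // so.
have := sorted_uniq tr ir so; elim: f {so} => //= e f IH /andP[ef uf].
case: eqP => [ec|_]; last by move/(IH uf)->; rewrite orbT.
suff -> : eval f c = 0%N by rewrite addn0 => ->.
move: ef; rewrite ec; elim: f {IH uf} => //= e' f IH.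
by rewrite inE negb_or eq_sym => /andP[/negPf -> /IH].
Qed.

Lemma eval_mem f c : (0 < eval f c)%N -> c \in [seq e.1 | e <- f].
Proof.
elim: f => //= e f IH; rewrite inE; case: eqP => [-> _|_ /IH ->]; by rewrite ?eqxx ?orbT.
Qed.

Variables (P : pred G) (leaf : seq G -> seq (G * nat) -> bool).

(* Depth-first search through the multisets of elements of [ts] added to [s],
   pruned when they stop being large; [f] represents [cnt P s].  The matches
   replace boolean connectives, which [vm_compute] evaluates eagerly. *)
Fixpoint explore n (ts : seq G) s f :=
  if n is n'.+1 then
    if ts is t :: ts' then
      if explore n' ts' s f then
        let f' := step t f in
        if big (2 ^ size (t :: s)) f' then explore n' ts (t :: s) f' else true
      else false
    else leaf s f
  else false.

(** Pruning is sound by [cnt_cat]: if [r ++ s] is large, its suffixes are large for some shift.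
    Running out of fuel yields [false], so success certifies that [n] suffices. *)
Lemma exploreP n ts s f r : transitive lt -> irreflexive lt ->
  (forall c, eval f c = cnt P s c) -> explore n ts s f ->
  {subset r <= ts} -> (exists c, (2 ^ size (r ++ s) < (cnt P (r ++ s) c).*2)%N) ->
  exists r' f', [/\ perm_eq r' (r ++ s), forall c, eval f' c = cnt P r' c & leaf r' f'].
Proof.
move=> tr ir; elim: n ts s f r => // n IH [|t ts] s f r fP /=.
  by case: r => [|w r] lf rt _; [exists s, f | have := rt w (mem_head _ _)].
case E: explore => // ex rt lr.
have [tr1|tr0] := boolP (t \in r); last first.
  apply: IH E _ lr => // w wr; have := rt w wr; rewrite inE.
  by case: eqP wr tr0 => // -> ->.
have pr : perm_eq (rem t r ++ (t :: s)) (r ++ s).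
  rewrite -cat1s catA perm_cat2r (perm_trans _ (_ : perm_eq (t :: rem t r) r)) //.
    by rewrite perm_catC.
  by rewrite perm_sym perm_to_rem.
have fP' c : eval (step t f) c = cnt P (t :: s) c by rewrite eval_step !fP.
move: ex; case: ifP => [_ ex|/negP nb _].
  have := IH _ _ _ (rem t r) fP' ex (fun w wr => rt w (mem_rem wr)).
  case; first by case: lr => c lr; exists c; rewrite (perm_size pr) (cnt_perm _ _ pr).
  by move=> r' [f' [p1 p2 p3]]; exists r', f'; split=> //; apply: perm_trans p1 pr.
case: lr => c; rewrite -(perm_size pr) -(cnt_perm _ _ pr) => /cnt_cat[d].
by rewrite -fP' => /(bigP tr ir).
Qed.
End Sparse.

Definition bit (z : int) := (z == 0) || (z == 1).
Notation tri := (int * int * int)%type.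
Definition bit3 (t : tri) := [&& bit t.1.1, bit t.1.2 & bit t.2].
Definition lt3 (a b : tri) : bool :=
  if a.1.1 == b.1.1 then if a.1.2 == b.1.2 then a.2 < b.2 else a.1.2 < b.1.2
  else a.1.1 < b.1.1.

Lemma lt3_trans : transitive lt3.
Proof.
rewrite /lt3; move=> [[b1 b2] b3] [[a1 a2] a3] [[c1 c2] c3] /=.
do ![case: ifP]; lia.
Qed.

Lemma lt3_irr : irreflexive lt3.
Proof. by rewrite /lt3; move=> [[a1 a2] a3]; rewrite /= !eqxx ltxx. Qed.

Definition nz1 (v : tri) := v.1.1 != 0.
Definition nz2 (v : tri) := v.1.2 != 0.
Definition nz3 (v : tri) := v.2 != 0.
Definition ovl v := nz1 v && nz2 v.

(* A list of triples is a 3-row matrix, given by its columns; each row is one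
   functional. *)
Definition distinct3 (s : seq tri) :=
  [&& (1 < count nz1 s)%N, (1 < count nz2 s)%N, (1 < count nz3 s)%N,
      has (fun v : tri => v.1.1 != v.1.2) s, has (fun v : tri => v.1.1 != - v.1.2) s,
      has (fun v : tri => v.1.1 != v.2) s, has (fun v : tri => v.1.1 != - v.2) s,
      has (fun v : tri => v.1.2 != v.2) s & has (fun v : tri => v.1.2 != - v.2) s].

(** Only the minors with the first row are tested: first entries in the core are nonzero, so their
    vanishing makes the core columns proportional. *)
Definition cored (s : seq tri) :=
  [&& (count ovl s <= 2)%N, (count (fun v => nz1 v && ~~ ovl v) s <= 1)%N,
      (count (fun v => nz2 v && ~~ ovl v) s <= 1)%N,
      (count (fun v => nz3 v && ~~ ovl v) s <= 1)%N
    & all (fun v => all (fun w => ovl v && ovl w ==>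
         (v.1.1 * w.1.2 == w.1.1 * v.1.2) && (v.1.1 * w.2 == w.1.1 * v.2)) s) s].

(* The fractions 1, 3/4, 5/8, 9/16 and 35/64 of [2 ^ k]. *)
Definition good k n :=
  n \in [seq (p.1 * 2 ^ (k - p.2))%N
        | p <- [:: (1, 0); (3, 2); (5, 3); (9, 4); (35, 6)]%N & (p.2 <= k)%N].

(** Shifts that are not keys have count 0, so testing the keys covers every large shift. *)
Definition leaf3 s (f : seq (tri * nat)) :=
  (distinct3 s ==> cored s) &&
  all (fun e => let n := eval f e.1 in
        if (2 ^ size s < n.*2)%N then good (size s) n else true) f.

(* The columns are taken up to sign, one representative [v] with [0 < v]
   lexicographically. *)
Definition types3 : seq tri :=
  let I := [:: -1; 0; 1] in
  [seq v <- [seq (p, c) | p <- [seq (a, b) | a <- I, b <- I], c <- I] | lt3 0 v].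

Definition cube3 : seq (tri * nat) :=
  let I := [:: 0; 1] in [seq ((p, c), 1%N) | p <- [seq (a, b) | a <- I, b <- I], c <- I].

(** The fuel 30 bounds the depth of the search, each call discarding a column type or adding a
    column. *)
Lemma explore3 : explore lt3 leaf3 30 types3 [::] cube3.
Proof. vm_cast_no_check (erefl true). Qed.

(** * Normal forms of triples of functionals *)

Definition unit_box (v : tri) :=
  [&& v.1.1 \in [:: -1; 0; 1], v.1.2 \in [:: -1; 0; 1] & v.2 \in [:: -1; 0; 1]].

Definition orient (v : tri) := if lt3 0 v then v else - v.

Lemma orient_sign v : orient v = v \/ orient v = - v.
Proof. by rewrite /orient; case: ifP; [left | right]. Qed.

Lemma orient_types v : unit_box v -> v != 0 -> orient v \in types3.
Proof.
case: v => [[a b] c] /and3P[] /=; rewrite !inE.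
by do 3![case/or3P=> /eqP->].
Qed.

Lemma nz_eqs (v : tri) :
  [/\ nz1 (- v) = nz1 v, nz2 (- v) = nz2 v & nz3 (- v) = nz3 v].
Proof. by case: v => [[a b] c]; rewrite /nz1 /nz2 /nz3 /= !oppr_eq0. Qed.

Lemma count_orient (p : pred tri) s : (forall v, p (- v) = p v) ->
  count p (map orient s) = count p s.
Proof. by move=> h; rewrite count_map; apply: eq_count => v /=; case: (orient_sign v) => ->. Qed.

Lemma has_orient (p : pred tri) s : (forall v, p (- v) = p v) ->
  has p (map orient s) = has p s.
Proof. by move=> h; rewrite !has_count count_orient. Qed.

Lemma all_orient (p : pred tri) s : (forall v, p (- v) = p v) ->
  all p (map orient s) = all p s.
Proof. by move=> h; rewrite !all_count count_orient ?size_map. Qed.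

(** Negating a column keeps its vanishing entries and their equalities, and changes both sides of a
    proportionality test by the same sign. *)
Lemma orient_stable s :
  (distinct3 (map orient s) = distinct3 s) * (cored (map orient s) = cored s).
Proof.
have [n1 n2 n3] : [/\ forall v, nz1 (- v) = nz1 v, forall v, nz2 (- v) = nz2 v
    & forall v, nz3 (- v) = nz3 v] by split=> v; case: (nz_eqs v).
have no v : ovl (- v) = ovl v by rewrite /ovl n1 n2.
split.
  by rewrite /distinct3 !count_orient // !has_orient //= => v; rewrite ?eqr_opp.
rewrite /cored !count_orient; try by move=> v; rewrite ?n1 ?n2 ?n3 ?no.
congr [&& _, _, _, _ & _]; rewrite all_orient => [|v].
  apply: eq_all => v; rewrite all_orient // => w.
  by rewrite no /= !mulrN !mulNr !eqr_opp.
by apply: eq_all => w; rewrite no /= !mulrN !mulNr !eqr_opp.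
Qed.

Lemma perm_stable s t : perm_eq s t ->
  (distinct3 s = distinct3 t) * (cored s = cored t).
Proof.
move=> st; have /permP ct := st; have mt := perm_mem st.
split; first by rewrite /distinct3 !has_count !ct.
rewrite /cored !ct (eq_all_r mt); congr [&& _, _, _, _ & _].
by apply: eq_all => v; rewrite (eq_all_r mt).
Qed.

Lemma nz_stable s (t := [seq v <- s | v != 0]) :
  (distinct3 t = distinct3 s) * (cored t = cored s).
Proof.
have cf (p : pred tri) : p 0 = false -> count p t = count p s.
  move=> p0; rewrite count_filter; apply: eq_count => v /=.
  by case: eqP => [->|]; rewrite ?p0 ?andbF ?andbT.
have af (p : pred tri) : p 0 -> all p t = all p s.
  move=> p0; rewrite all_filter; apply: eq_all => v /=.
  by case: eqP => [->|]; rewrite ?p0.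
split; first by rewrite /distinct3 !has_count !cf.
rewrite /cored !cf //; congr [&& _, _, _, _ & _]; rewrite af.
  by apply: eq_all => v; rewrite af //= andbF.
by apply/allP.
Qed.

Lemma good_scale k z n : good k n -> good (k + z) (n * 2 ^ z)%N.
Proof.
rewrite /good => /mapP[p]; rewrite mem_filter => /andP[pk pl] ->.
apply/mapP; exists p; last by rewrite -mulnA -expnD addnBAC.
by rewrite mem_filter pl (leq_trans pk) ?leq_addr.
Qed.

(** Deleting zero columns scales count and cube by the same power of 2; orienting the others only
    changes the shift. The result is, up to order, a multiset reached by the search. *)
Lemma triple_table (s : seq tri) c : all unit_box s ->
  (2 ^ size s < (cnt bit3 s c).*2)%N ->
  good (size s) (cnt bit3 s c) /\ (distinct3 s -> cored s).
Proof.
move=> bs; set t := [seq v <- s | v != 0].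
have sz : size s = (size t + count (pred1 0%R) s)%N.
  by rewrite size_filter addnC -(count_predC (pred1 0) s).
rewrite cnt_nz -/t sz expnD -muln2 mulnAC ltn_pmul2r ?expn_gt0 // muln2 => ht.
rewrite -!(nz_stable s) -/t.
have [d hd] := cnt_sign bit3 t orient_sign.
have so := size_map orient t.
have tP : {subset map orient t <= types3}.
  move=> w /mapP[v]; rewrite mem_filter => /andP[v0 /(allP bs) bv] ->.
  exact: orient_types.
have f0 e : eval cube3 e = cnt bit3 [::] e.
  case: e => [[x y] z]; rewrite /cube3 /bit3 /bit /= !xpair_eqE ![_ == x]eq_sym.
  rewrite ![_ == y]eq_sym ![_ == z]eq_sym.
  by have [->|_] := eqVneq x 0; have [->|_] := eqVneq y 0; have [->|_] := eqVneq z 0;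
    rewrite //=; do ?case: eqP.
case: (exploreP lt3_trans lt3_irr f0 explore3 tP).
  by exists (c + d); rewrite cats0 so hd.
move=> r [f]; rewrite cats0 => -[pr fP /andP[l1 /allP l2]].
split; last by move: l1; rewrite !(perm_stable pr) !orient_stable => /implyP.
apply: good_scale; rewrite -hd -so -(cnt_perm _ _ pr) -fP -(perm_size pr).
move: ht; rewrite -hd -so -(cnt_perm _ _ pr) -fP -(perm_size pr) => ht.
have /mapP[e ef ee] : (c + d) \in [seq e.1 | e <- f].
  by apply: eval_mem; lia.
by have := l2 e ef; rewrite /= -ee ht.
Qed.

(** * Subset sums as values on the cube *)

Definition lc (G : zmodType) k (u : 'I_k -> G) (x : {ffun 'I_k -> bool}) : G :=
  \sum_i u i *+ x i.

Lemma card_cnt (G : zmodType) (P : pred G) k (u : 'I_k -> G) c :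
  #|[set x | P (c + lc u x)]| = cnt P [seq u i | i <- enum 'I_k] c.
Proof.
rewrite -sum1dep_card big_mkcond /=; elim: k u c => [|k IH] u c.
  rewrite enum_ord0 /= (big_pred1 [ffun=> false]) => [|x].
    by rewrite /lc big_ord0 addr0; case: (P c).
  by apply/esym/eqP/ffunP => -[].
pose h (p : bool * {ffun 'I_k -> bool}) : {ffun 'I_k.+1 -> bool} :=
  [ffun i => if unlift ord0 i is Some j then p.2 j else p.1].
have hb : bijective h.
  exists (fun x : {ffun 'I_k.+1 -> bool} => (x ord0, [ffun i : 'I_k => x (lift ord0 i)]))
    => [[b x]|x].
    by congr pair; [rewrite ffunE unlift_none | apply/ffunP=> i; rewrite !ffunE liftK].
  by apply/ffunP=> i; rewrite !ffunE; case: unliftP => [j ->|->]; rewrite ?ffunE.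
rewrite (reindex h) /=; last exact: onW_bij.
rewrite -(pair_bigA _ (fun b x => if P (c + lc u (h (b, x))) then 1%N else 0%N)) /=.
have hE b x : lc u (h (b, x)) = u ord0 *+ b + lc (fun i => u (lift ord0 i)) x.
  rewrite /lc big_ord_recl ffunE unlift_none; congr (_ + _).
  by apply: eq_bigr => i _; rewrite ffunE liftK.
rewrite big_bool /= enum_ordSl /= -map_comp -!IH addnC.
by congr addn; apply: eq_bigr => x _; rewrite hE /= ?add0r ?addrA.
Qed.

Lemma card_half (G : zmodType) (P : pred G) k (u : 'I_k -> G) i :
  (forall d, ~~ (P d && P (d + u i))) -> (#|[set x | P (lc u x)]|.*2 <= 2 ^ k)%N.
Proof.
move=> hP; have -> : #|[set x | P (lc u x)]| = #|[set x | P (0 + lc u x)]|.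
  by apply: eq_card => x; rewrite !inE add0r.
rewrite card_cnt -[X in (_ <= 2 ^ X)%N](size_enum_ord k) -(size_map u).
by apply: cnt_half hP; rewrite map_f ?mem_enum.
Qed.

(** * Unions of subcubes *)

Section Subcubes.
Variable I : finType.
Implicit Types (v c a : {ffun I -> int}) (s : seq {ffun I -> int}).

Definition bits c := [forall j, bit (c j)].
Definition sparse s := forall j, (count (fun v => v j != 0) s <= 1)%N.

(* Where all of [s] vanishes, only [bit (c j)] matters, not [c j] itself. *)
Lemma cnt_ext s c c' :
  (forall j, c j = c' j \/
    [/\ bit (c j), bit (c' j) & all (fun v : {ffun I -> int} => v j == 0) s]) ->
  cnt bits s c = cnt bits s c'.
Proof.
elim: s c c' => [|v s IH] c c' h /=.
  by congr nat_of_bool; apply: eq_forallb => j; case: (h j) => [->|[-> ->]].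
by congr addn; apply: IH => j; rewrite ?ffunE;
  case: (h j) => [->|[b b' /andP[/eqP v0 az]]]; rewrite ?v0 ?addr0; by [left | right].
Qed.

Lemma cnt_bit s c j : (0 < cnt bits s c)%N ->
  all (fun v : {ffun I -> int} => v j == 0) s -> bit (c j).
Proof.
elim: s c => [|v s IH] c /=.
  by rewrite lt0b => /forallP /(_ j).
case: (posnP (cnt bits s c)) => [->|h _ /andP[_ az]]; last exact: IH.
by move=> h /andP[/eqP v0 az]; have := IH _ h az; rewrite ffunE v0 addr0.
Qed.

Lemma sparse_cons v s : sparse (v :: s) ->
  sparse s /\ forall j, v j != 0 -> all (fun w : {ffun I -> int} => w j == 0) s.
Proof.
move=> sp; split=> j; first by apply: leq_trans (sp j); rewrite leq_addl.
move=> vj; have := sp j; rewrite /= vj add1n ltnS leqn0.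
by rewrite -[all _ _]negbK -has_predC has_count -eqn0Ngt.
Qed.

(** Where [v] is nonzero, the rest of the list vanishes. If both choices for [v] leave solutions,
    [c] and [c + v] are thus bits wherever they differ, and the two counts agree. *)
Lemma subcube s c : sparse s ->
  cnt bits s c = 0%N \/ exists2 i, (i <= size s)%N & cnt bits s c = (2 ^ i)%N.
Proof.
elim: s c => [|v s IH] c sp /=.
  by case: (bits c); [right; exists 0%N | left].
have [sp' vz] := sparse_cons sp.
case: (IH c sp') => [->|[i si e1]].
  by case: (IH (c + v) sp') => [->|[i si ->]]; [left | right; exists i; rewrite ?leqW].
case: (IH (c + v) sp') => [->|[i' si' e2]].
  by right; exists i; rewrite ?addn0 ?leqW.
right; exists i.+1 => //; rewrite expnS mul2n -addnn; congr addn => //.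
rewrite -e1; apply: cnt_ext => j; have [v0|v0] := eqVneq (v j) 0.
  by left; rewrite ffunE v0 addr0.
right; split; last exact: vz.
  by apply: (cnt_bit _ (vz _ v0)); rewrite e2 expn_gt0.
by apply: (cnt_bit _ (vz _ v0)); rewrite e1 expn_gt0.
Qed.

(** Complementing the subset matches the exchange of 0 and 1 in the target. *)
Lemma cnt_compl s c : cnt bits s ([ffun=> 1] - c - \sum_(v <- s) v) = cnt bits s c.
Proof.
elim: s c => [|v s IH] c /=.
  rewrite big_nil subr0; congr nat_of_bool; apply: eq_forallb => j.
  rewrite !ffunE /bit; move: (c j) => z; lia.
rewrite big_cons opprD !addrA [cnt _ _ (_ + v)](_ : _ = cnt bits s c); last first.
  by rewrite addrAC -[_ - v + v]addrA addNr addr0 IH.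
by rewrite -[_ - c - v]addrA -opprD IH addnC.
Qed.

Lemma full_cons v s c : cnt bits (v :: s) c = (2 ^ size (v :: s))%N ->
  cnt bits s c = (2 ^ size s)%N /\ cnt bits s (c + v) = (2 ^ size s)%N.
Proof.
have tight (a b p : nat) : (a <= p -> b <= p -> a + b = 2 * p -> a = p /\ b = p)%N by lia.
by rewrite /= expnS; apply: tight; apply: cnt_le.
Qed.

Lemma full_bits s c : cnt bits s c = (2 ^ size s)%N -> bits c.
Proof. by elim: s => [|v s IH]; [rewrite /=; case: (bits c) | case/full_cons=> /IH]. Qed.

(* If every subset sum shifted by [c] is a bit vector, then complementing the
   subset exchanges the shifts [c - a] and [c + a]; this fails only at a
   coordinate that vanishes on [s] but not on [a], where one of the two shifts
   leaves no solution at all. *)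
Lemma full_symm s c a : sparse s -> cnt bits s c = (2 ^ size s)%N ->
  [\/ cnt bits s (c - a) = 0%N, cnt bits s (c + a) = 0%N
    | cnt bits s (c - a) = cnt bits s (c + a)].
Proof.
move=> sp full; have /forallP cb := full_bits full.
case: (posnP (cnt bits s (c - a))) => [|p1]; first by constructor 1.
case: (posnP (cnt bits s (c + a))) => [|p2]; first by constructor 2.
constructor 3; rewrite -[RHS]cnt_compl; apply: cnt_ext => j.
rewrite !ffunE sum_ffunE.
have [az|] := boolP (all (fun v : {ffun I -> int} => v j == 0) s).
  have := cnt_bit p1 az; have := cnt_bit p2 az; have := cb j.
  rewrite !ffunE big_seq big1 => [|v /(allP az)/eqP //].
  rewrite /bit => c1 c2 c3; right; split=> //; lia.
(* Here [c j] and [c j + v j] are distinct bits, so they add up to 1; hence [c j - a j] equals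
   [1 - (c j + a j) - v j]. *)
rewrite -has_predC => /hasP[v vs /= v0]; left.
have ps := perm_to_rem vs; rewrite (perm_big _ ps) big_cons /=.
have sp' : sparse (v :: rem v s) by move=> i; rewrite -(permP ps).
have [_ /(_ j v0) az] := sparse_cons sp'.
move: full; rewrite (cnt_perm _ _ ps) (perm_size ps) => /full_cons[_ /full_bits/forallP].
move=> /(_ j); have := cb j; rewrite ffunE [X in v j + X]big_seq big1 => [|w /(allP az)/eqP //].
by move: (c j) (v j) (a j) v0 => x y z; rewrite /bit; lia.
Qed.
End Subcubes.

(** * Sums of subcube sizes *)

Definition pow2_or_0 k n := n = 0%N \/ exists2 i, (i <= k)%N & n = (2 ^ i)%N.

Lemma pow2_or_0P k n : pow2_or_0 k n ->
  [\/ n = 0%N, n = (2 ^ k)%N | exists i, [/\ (i < k)%N, n = (2 ^ i)%N & (n.*2 <= 2 ^ k)%N]].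
Proof.
case=> [->|[i]]; first by constructor 1.
rewrite leq_eqVlt => /predU1P[-> ->|ik ->]; first by constructor 2.
by constructor 3; exists i; split=> //; rewrite -mul2n -expnS leq_exp2l.
Qed.

(** If neither size is [2 ^ k], both are at most half of it and the sum is too small; so one is
    [2 ^ k] and the other is nonzero. *)
Lemma large_sum2 k A B : pow2_or_0 k A -> pow2_or_0 k B ->
  (2 ^ k.+1 < (A + B).*2)%N -> exists2 i, (i < k.+1)%N & (A + B = 2 ^ k + 2 ^ i)%N.
Proof.
rewrite expnS => /pow2_or_0P hA /pow2_or_0P hB; set p := (2 ^ k)%N in hA hB *.
case: hA => [->|->|[i [ik -> hi]]]; case: hB => [->|->|[j [jk -> hj]]] h; try lia.
- by exists k => //; lia.
- by exists j => //; lia.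
- by exists i; lia.
Qed.

(* [B], [A], [A], [C] are the sizes of the four subcubes over a two-element core. *)
Lemma large_sum4 k A B C : pow2_or_0 k A -> pow2_or_0 k B -> pow2_or_0 k C ->
  (A = 2 ^ k -> [\/ B = 0, C = 0 | B = C])%N ->
  (2 ^ k.+2 < (B + A.*2 + C).*2)%N ->
  exists2 i, (i < k.+2)%N & (B + A.*2 + C = 2 ^ k.+1 + 2 ^ i)%N.
Proof.
move=> hA hB hC; rewrite !expnS; set p := (2 ^ k)%N => full large.
have sw n : (exists2 i, i <= k & n = 2 * p + 2 ^ i)%N ->
            exists2 i, (i < k.+2)%N & (n = 2 * p + 2 ^ i)%N.
  by case=> i ik ->; exists i => //; lia.
have p0 : (0 < p)%N by rewrite expn_gt0.
case: (pow2_or_0P hA) => [A0|Ap|[i [ik Ai A2]]].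
- have := hB; have := hC.
  case/pow2_or_0P=> [C0|Cp|[j [_ _ C2]]]; case/pow2_or_0P=> [B0|Bp|[l [_ _ B2]]];
    rewrite -/p in large *; lia.
- rewrite Ap -/p in full large *; case: (full erefl) => [B0|C0|BC].
  + apply: sw; case: hC => [C0|[j jk ->]]; [lia | exists j; lia].
  + apply: sw; case: hB => [B0|[j jk ->]]; [lia | exists j; lia].
  + rewrite BC in large *; case: hC => [C0|[j jk ->]]; first lia.
    by exists j.+1; rewrite ?expnS; lia.
have A2i : (A.*2 = 2 ^ i.+1)%N by rewrite Ai expnS mul2n.
(* In the second case only [B = C = p] gives a large sum; in the first, one of [B] and [C] must be
   [p] and the other nonzero. *)
have A4 : (A.*2 = p \/ A.*2.*2 <= p)%N.
  move: ik; rewrite A2i leq_eqVlt => /predU1P[->|ik]; [by left | right].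
  by rewrite -mul2n -expnS leq_exp2l.
rewrite -/p in A2.
case: (pow2_or_0P hB) => [B0|Bp|[j [jk Bj B2]]];
case: (pow2_or_0P hC) => [C0|Cp|[l [lk Cl C2]]]; rewrite -/p in large *; try lia.
- by apply: sw; exists i.+1 => //; lia.
- by apply: sw; exists l; lia.
- by apply: sw; exists j; lia.
Qed.

Lemma lc_tri k (u1 u2 u3 : 'I_k -> int) x :
  lc (fun i => (u1 i, u2 i, u3 i) : tri) x = (lc u1 x, lc u2 x, lc u3 x).
Proof.
rewrite /lc; elim: (index_enum _) => [|i r IH]; rewrite ?big_nil // !big_cons IH.
by case: (x i); rewrite ?mulr0n ?mulr1n ?add0r.
Qed.

Lemma count_enum (T : finType) (p : pred T) : count p (enum T) = #|p|.
Proof. by rewrite cardE size_filter enumT. Qed.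

(** * Classification of large systems *)

Section Classification.
Variables (k n : nat) (L : 'I_n -> 'I_k -> int).
Hypothesis L_unit : forall j i, L j i \in [:: -1; 0; 1].
Let V := [set x | [forall j, bit (lc (L j) x)]].
Hypothesis V_large : (2 ^ k < #|V|.*2)%N.

Lemma large_sub (W : {set {ffun 'I_k -> bool}}) : V \subset W -> (2 ^ k < #|W|.*2)%N.
Proof. by move/subset_leq_card => VW; rewrite (leq_trans V_large) ?leq_double. Qed.

Lemma in_V x j : x \in V -> bit (lc (L j) x).
Proof. by rewrite inE => /forallP. Qed.

(** The zero set of [L j] contains at most one end of each edge in direction [i], hence at most half
    of the cube. *)
Lemma not_all_zero j i : L j i != 0 -> exists2 x, x \in V & lc (L j) x != 0.
Proof.
move=> Lji; apply/exists_inP; apply: contraLR V_large => /exists_inPn V0.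
rewrite -leqNgt.
have sub : V \subset [set x | lc (L j) x == 0].
  by apply/subsetP => x /V0; rewrite inE negbK.
apply: (@leq_trans #|[set x | lc (L j) x == 0]|.*2).
  by rewrite leq_double subset_leq_card.
apply: (@card_half _ (fun z => z == 0) _ _ i) => d.
by apply/negP=> /andP[/eqP->]; rewrite add0r (negPf Lji).
Qed.

(* The functionals outside [J] are identically 0 or a single coordinate. *)
Let J := [set j | (1 < #|[set i | L j i != 0%R]|)%N].

(** A single coefficient -1 would force the functional to vanish on [V], against [not_all_zero]. *)
Lemma trivial_bit j x : j \notin J -> bit (lc (L j) x).
Proof.
rewrite inE -leqNgt => J1.
have [i Li|L0] := pickP (fun i => L j i != 0); last first.
  by rewrite /lc big1 // => i _; have /negbFE/eqP-> := L0 i; rewrite mul0rn.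
have lcE y : lc (L j) y = L j i *+ y i.
  rewrite /lc (bigD1 i) //= big1 ?addr0 // => i' ne; apply/eqP.
  rewrite mulrn_eq0; apply/orP; right; apply: contraR ne => Li'.
  by apply/eqP/(card_le1_eqP J1); rewrite inE.
have := L_unit j i; rewrite !inE (negPf Li) /= => /orP[/eqP Lm|/eqP L1]; last first.
  by rewrite lcE L1 /bit; case: (x i).
have [y yV] := not_all_zero Li.
by have := in_V j yV; rewrite lcE Lm /bit; case: (y i).
Qed.

Definition same j j' := [forall i, L j i == L j' i].

(** If [z] and [- z] are both bits, then [z = 0]; so opposite functionals would vanish on [V]. *)
Lemma not_opposite j j' : j \in J -> has (fun i => L j i != - L j' i) (enum 'I_k).
Proof.
move=> jJ; rewrite -[has _ _]negbK -all_predC; apply/negP => /allP opp.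
have {}opp i : L j i = - L j' i by have := opp i; rewrite mem_enum /= negbK => /(_ isT)/eqP.
have [i Li] : exists i, L j i != 0.
  move: jJ; rewrite inE => /ltnW/card_gt0P[i]; rewrite inE => Li; by exists i.
have [x xV] := not_all_zero Li.
have lcE : lc (L j) x = - lc (L j') x.
  by rewrite /lc -sumrN; apply: eq_bigr => i' _; rewrite opp mulNrn.
by have := in_V j xV; have := in_V j' xV; rewrite lcE /bit; move: (lc _ _) => z; lia.
Qed.

Definition tripled j1 j2 j3 := [seq (L j1 i, L j2 i, L j3 i) : tri | i <- enum 'I_k].

Lemma tripled_table j1 j2 j3 (W := [set x | bit3 (lc (L j1) x, lc (L j2) x, lc (L j3) x)]) :
  good k #|W| /\ (distinct3 (tripled j1 j2 j3) -> cored (tripled j1 j2 j3)).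
Proof.
have WE : #|W| = cnt bit3 (tripled j1 j2 j3) 0.
  by rewrite -card_cnt; apply: eq_card => x; rewrite !inE add0r lc_tri.
have sz : size (tripled j1 j2 j3) = k by rewrite size_map size_enum_ord.
rewrite WE -[X in good X _]sz; apply: triple_table.
  by apply/allP => v /mapP[i _ ->]; rewrite /unit_box /= !L_unit.
rewrite sz -WE; apply: large_sub; apply/subsetP => x xV.
by rewrite inE /bit3 /= !in_V.
Qed.

(** [V] is the solution set of the triple [j1], [j2], [j2], to which the table applies. *)
Lemma two_functionals j1 j2 : (forall j, j \in J -> same j1 j || same j2 j) -> good k #|V|.
Proof.
move=> two; have [+ _] := tripled_table j1 j2 j2; congr (good _ _).
apply: eq_card => x; rewrite !inE /bit3 /= andbb; apply/andP/forallP => [[b1 b2] j|h] //.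
have lcE j' : same j' j -> lc (L j') x = lc (L j) x.
  by move=> /forallP e; apply: eq_bigr => i _; rewrite (eqP (e i)).
have [/two/orP[/lcE|/lcE]|/trivial_bit->//] := boolP (j \in J); by move <-.
Qed.

Lemma distinct_cored j1 j2 j3 : j1 \in J -> j2 \in J -> j3 \in J ->
  ~~ same j1 j2 -> ~~ same j1 j3 -> ~~ same j2 j3 -> cored (tripled j1 j2 j3).
Proof.
move=> J1 J2 J3 n12 n13 n23; have [_] := tripled_table j1 j2 j3; apply.
have ns j j' : ~~ same j j' -> has (fun i => L j i != L j' i) (enum 'I_k).
  by move=> /forallPn[i ne]; apply/hasP; exists i; rewrite ?mem_enum.
have cJ j : j \in J -> (1 < count (fun i => L j i != 0%R) (enum 'I_k))%N.
  by rewrite inE count_enum cardsE.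
have ct p : count p (tripled j1 j2 j3) = count (fun i => p (L j1 i, L j2 i, L j3 i)) (enum 'I_k).
  by rewrite count_map.
rewrite /distinct3 ![has _ (tripled _ _ _)]has_count !ct -!has_count.
by do ![apply/andP; split]; first [exact: cJ | exact: ns | exact: not_opposite].
Qed.

(** The core [O] depends on [j1] and [j2] only, so the table applies to [j1], [j2] and any further
    [j]; if [j] repeats one of them, the triple with [j3] gives the claim. *)
Lemma core_facts j1 j2 j3 (O := [set i | (L j1 i != 0) && (L j2 i != 0)]) :
  j1 \in J -> j2 \in J -> j3 \in J ->
  ~~ same j1 j2 -> ~~ same j1 j3 -> ~~ same j2 j3 ->
  [/\ (#|O| <= 2)%N,
    forall j, j \in J -> (#|[set i | (L j i != 0%R) && (i \notin O)]| <= 1)%N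
    & forall j a b, j \in J -> a \in O -> b \in O -> L j1 a * L j b = L j1 b * L j a].
Proof.
move=> J1 J2 J3 n12 n13 n23.
have ct j p : count p (tripled j1 j2 j) = #|[set i | p (L j1 i, L j2 i, L j i)]|.
  by rewrite count_map count_enum cardsE; apply: eq_card.
have sets (A B : {set 'I_k}) : A = B -> (#|A| <= 1)%N -> (#|B| <= 1)%N by move->.
have core j : cored (tripled j1 j2 j) ->
  [/\ (#|O| <= 2)%N, (#|[set i | (L j1 i != 0%R) && (i \notin O)]| <= 1)%N,
      (#|[set i | (L j2 i != 0%R) && (i \notin O)]| <= 1)%N,
      (#|[set i | (L j i != 0%R) && (i \notin O)]| <= 1)%N
    & forall a b, a \in O -> b \in O ->
      L j1 a * L j2 b = L j1 b * L j2 a /\ L j1 a * L j b = L j1 b * L j a].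
  case/and5P; rewrite !ct => c0 c1 c2 c3 /allP c4.
  split=> [||||a b aO bO]; first by [].
  - by apply: sets c1; apply/setP=> i; rewrite !inE.
  - by apply: sets c2; apply/setP=> i; rewrite !inE.
  - by apply: sets c3; apply/setP=> i; rewrite !inE.
  have tm i : (L j1 i, L j2 i, L j i) \in tripled j1 j2 j.
    by apply/mapP; exists i; rewrite ?mem_enum.
  have /allP/(_ _ (tm b))/implyP := c4 _ (tm a).
  rewrite /ovl /nz1 /nz2 /=; move: aO bO; rewrite !inE => -> -> /(_ isT).
  by case/andP=> /eqP-> /eqP->.
have [C0 C1 C2 _ C3] := core _ (distinct_cored J1 J2 J3 n12 n13 n23).
have col j j' : same j j' -> L j =1 L j' by move=> /forallP e i; apply/eqP.
have part2 j : j \in J -> (#|[set i | (L j i != 0%R) && (i \notin O)]| <= 1)%N /\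
    forall a b, a \in O -> b \in O -> L j1 a * L j b = L j1 b * L j a.
  move=> jJ; have [/col e|n1] := boolP (same j1 j).
    split; first by apply: sets C1; apply/setP=> i; rewrite !inE e.
    by move=> a b _ _; rewrite -!e mulrC.
  have [/col e|n2] := boolP (same j2 j).
    split; first by apply: sets C2; apply/setP=> i; rewrite !inE e.
    by move=> a b aO bO; rewrite -!e; case: (C3 a b aO bO).
  have [_ _ _ C4 C5] := core _ (distinct_cored J1 J2 jJ n12 n1 n2).
  by split=> // a b aO bO; case: (C5 a b aO bO).
by split=> // [j /part2[]|j a b /part2[_]] //; apply.
Qed.

Lemma three_functionals j1 j2 j3 :
  j1 \in J -> j2 \in J -> j3 \in J ->
  ~~ same j1 j2 -> ~~ same j1 j3 -> ~~ same j2 j3 ->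
  exists2 i, (i < k)%N & #|V| = (2 ^ k.-1 + 2 ^ i)%N.
Proof.
move=> J1 J2 J3 n12 n13 n23; have [] := core_facts J1 J2 J3 n12 n13 n23.
set O := [set i | _] => O2 offO propO.
(* Zeroing the functionals outside [J] leaves [V] unchanged by [trivial_bit], and lets the core
   facts govern whole columns. *)
pose M i : {ffun 'I_n -> int} := [ffun j => if j \in J then L j i else 0].
have VE : #|V| = cnt (@bits _) [seq M i | i <- enum 'I_k] 0.
  rewrite -card_cnt; apply: eq_card => x; rewrite !inE add0r.
  apply: eq_forallb => j; rewrite /lc sum_ffunE.
  have [jJ|jJ] := boolP (j \in J).
    by congr bit; apply: eq_bigr => i _; case: (x i); rewrite ?mulr0n ?mulr1n !ffunE ?jJ.
  rewrite (trivial_bit x jJ) big1 // => i _.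
  by case: (x i); rewrite ?mulr0n ?mulr1n !ffunE ?(negPf jJ).
set rest := [seq M i | i <- enum (~: O)].
have sp : sparse rest.
  move=> j; rewrite count_map; have [jJ|jJ] := boolP (j \in J); last first.
    rewrite (eq_count (a2 := pred0)) ?count_pred0 // => i /=.
    by rewrite ffunE (negPf jJ).
  apply: leq_trans (offO j jJ); rewrite cardE -size_filter /enum_mem -filter_predI.
  rewrite eq_leq //; congr size; apply: eq_filter => i /=.
  by rewrite ffunE jJ !inE.
have szr : (size rest + #|O|)%N = k.
  by rewrite size_map -cardE addnC cardsC card_ord.
have pw c : pow2_or_0 (size rest) (cnt (@bits _) rest c) by exact: subcube.
have pe : perm_eq [seq M i | i <- enum 'I_k] ([seq M i | i <- enum O] ++ rest).
  rewrite -map_cat perm_map // uniq_perm ?enum_uniq // ?cat_uniq ?enum_uniq /=.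
    by rewrite andbT; apply/hasPn => i; rewrite !mem_enum inE.
  by move=> i; rewrite mem_cat !mem_enum !inE orbN.
move: V_large; rewrite VE (cnt_perm _ _ pe).
have : size (enum O) = #|O| by rewrite -cardE.
case EO: (enum O) => [|a [|b [|c r]]] /= sO; last by move: O2; rewrite -sO.
(* Empty core: a single large subcube is the whole cube, of size [2 ^ k.-1 + 2 ^ k.-1]. *)
- case/pow2_or_0P: (pw 0) => [->|->|[i [_ -> hi]]] h; last 1 first.
  + by have := leq_trans h hi; rewrite -szr -sO addn0 ltnn.
  + by [].
  exists k.-1; first by move: J1; rewrite inE => /ltnW/card_gt0P[[m mk]] _; lia.
  have k0 : (0 < k)%N by move: J1; rewrite inE => /ltnW/card_gt0P[[m mk]] _; lia.
  by move: szr; rewrite -sO addn0 => ->; rewrite -{1}(prednK k0) expnS mul2n addnn.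
- have kE : k = (size rest).+1 by rewrite -szr -sO addn1.
  by rewrite kE /= => h; apply: large_sum2.
have kE : k = (size rest).+2 by rewrite -szr -sO addn2.
have [aO bO] : a \in O /\ b \in O.
  by split; rewrite -mem_enum EO !inE eqxx ?orbT.
(* As [L j1 a] is a sign, proportionality makes column [b] equal to column [a] up to one sign common
   to all [j] in [J]. *)
have Lj1 : L j1 a * L j1 a = 1.
  move: aO; rewrite inE => /andP[a1 _]; have := L_unit j1 a.
  by rewrite !inE (negPf a1) /= => /orP[]/eqP->.
have ab j : j \in J -> L j b = (L j1 a * L j1 b) * L j a.
  by move=> jJ; rewrite -mulrA -(propO _ _ _ jJ aO bO) mulrA Lj1 mul1r.
have : M b = M a \/ M b = - M a.
  have : L j1 a * L j1 b = 1 \/ L j1 a * L j1 b = -1.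
    have := L_unit j1 a; have := L_unit j1 b; move: aO bO; rewrite !inE.
    move=> /andP[/negPf-> _] /andP[/negPf-> _] /=.
    by move=> /orP[]/eqP-> /orP[]/eqP->; [left|right|right|left].
  case=> e; [left|right]; apply/ffunP => j; rewrite !ffunE; case: ifP => [/ab->|];
    by rewrite ?e ?mul1r ?mulN1r ?oppr0.
rewrite kE /= !add0r => -[]->.
  (* Equal columns: the shifts 0, [M a], [M a], [M a + M a] are centred at [M a]. *)
  have -> : (cnt (@bits _) rest 0 + cnt (@bits _) rest (M a) +
     (cnt (@bits _) rest (M a) + cnt (@bits _) rest (M a + M a)) =
     cnt (@bits _) rest (M a - M a) + (cnt (@bits _) rest (M a)).*2
       + cnt (@bits _) rest (M a + M a))%N.
    by rewrite subrr -addnn !addnA.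
  by apply: large_sum4 => // /full_symm; apply.
(* Opposite columns: the shifts [- M a], 0, 0, [M a] are centred at 0. *)
have -> : (cnt (@bits _) rest 0 + cnt (@bits _) rest (- M a) +
     (cnt (@bits _) rest (M a) + cnt (@bits _) rest (M a - M a)) =
     cnt (@bits _) rest (0 - M a) + (cnt (@bits _) rest 0).*2
       + cnt (@bits _) rest (0 + M a))%N.
  have swap (x y z : nat) : (x + y + (z + x) = y + x.*2 + z)%N by lia.
  by rewrite subrr sub0r add0r swap.
by apply: large_sum4 => // /full_symm; apply.
Qed.

Lemma classification : (0 < k)%N ->
  good k #|V| \/ exists2 i, (i < k)%N & #|V| = (2 ^ k.-1 + 2 ^ i)%N.
Proof.
move=> k0; have [j1 J1|noJ] := pickP (mem J); last first.
  right; exists k.-1; first by rewrite prednK.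
  rewrite addnn -mul2n -expnS prednK // -[k in RHS]card_ord -card_bool -card_ffun.
  rewrite -cardsT; apply: eq_card => x; rewrite !inE; apply/forallP => j.
  by apply: trivial_bit; have /= -> := noJ j.
have [j2 /andP[J2 n12]|no2] := pickP [pred j in J | ~~ same j1 j]; last first.
  left; apply: (@two_functionals j1 j1) => j jJ.
  by have := no2 j; rewrite /= jJ /= => /negbFE->.
have [j3 /and3P[J3 n13 n23]|no3] := pickP [pred j | [&& j \in J, ~~ same j1 j & ~~ same j2 j]].
  by right; apply: (three_functionals J1 J2 J3).
left; apply: (@two_functionals j1 j2) => j jJ.
by have := no3 j; rewrite /= jJ /= -negb_or => /negbFE.
Qed.
End Classification.

(** * Subspaces and attained sizes *)

Section Reparametrization.
Variable R : realType.

Definition rbit (z : R) := (z == 0) || (z == 1).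

Lemma rbit_nat (b : bool) : rbit b%:R.
Proof. by case: b; rewrite /rbit eqxx ?orbT. Qed.

Lemma rbit_int z : rbit z%:~R = bit z.
Proof. by rewrite /rbit /bit intr_eq0 -[1]/(1%:~R) eqr_int. Qed.

Lemma lc_int k (u : 'I_k -> int) x : lc (fun i => (u i)%:~R : R) x = (lc u x)%:~R.
Proof. by rewrite /lc rmorph_sum; apply: eq_bigr => i _; rewrite rmorphMn. Qed.

(** The columns chosen by [f] form the identity, so the coefficients of a cube point in the row
    space are its own entries at [f], hence bits. *)
Lemma cube_count_basis k n (A : 'M[R]_(k, n)) (f : 'I_k -> 'I_n) :
  colsub f A = 1%:M ->
  cube_count A = #|[set x | [forall j, rbit (lc (fun i => A i j) x)]]|.
Proof.
move=> Af; pose g (b : {ffun 'I_n -> bool}) : {ffun 'I_k -> bool} := [ffun i => b (f i)].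
have lcE x j : (cube_pt R x *m A) 0 j = lc (fun i => A i j) x.
  by rewrite mxE; apply: eq_bigr => i _; rewrite mxE mulr_natl.
have gP b : (cube_pt R b <= A)%MS -> cube_pt R b = cube_pt R (g b) *m A.
  case/submxP => y yA; rewrite [LHS]yA; congr (_ *m _).
  rewrite -[y]mulmx1 -Af; apply/rowP => i.
  have -> : (y *m colsub f A) 0 i = (y *m A) 0 (f i).
    by rewrite !mxE; apply: eq_bigr => i' _; rewrite !mxE.
  by rewrite -yA !mxE ffunE.
have gE b j : (cube_pt R b <= A)%MS -> (b j)%:R = lc (fun i => A i j) (g b).
  by move=> bA; rewrite -lcE -gP // mxE.
rewrite /cube_count -(@card_in_imset _ _ g) => [|b b']; last first.
  rewrite !inE => bA bA' gbb; apply/ffunP => j; have := gE b j bA.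
  by rewrite gbb -gE // => /eqP; rewrite eqr_nat; case: (b j); case: (b' j).
apply: eq_card => x; rewrite inE; apply/imsetP/forallP => [[b + ->] j|xA].
  by rewrite inE => bA; rewrite -gE // rbit_nat.
exists [ffun j => lc (fun i => A i j) x == 1].
  rewrite inE; apply/submxP; exists (cube_pt R x); apply/rowP => j.
  rewrite lcE !mxE ffunE; case/orP: (xA j) => /eqP->; by rewrite ?eqxx // eq_sym oner_eq0.
apply/ffunP => i; rewrite !ffunE /lc (bigD1 i) //= big1 => [|i' ne].
  by have /matrixP/(_ i i) := Af; rewrite !mxE eqxx => ->;
    case: (x i); rewrite ?addr0 ?eqxx // eq_sym oner_eq0.
by have /matrixP/(_ i' i) := Af; rewrite !mxE (negPf ne) => ->; rewrite mul0rn.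
Qed.

Lemma cube_count_rank k n (A : 'M[R]_(k, n)) : \rank A = k ->
  exists L : 'M[R]_(k, n),
    cube_count A = #|[set x | [forall j, rbit (lc (fun i => L i j) x)]]|.
Proof.
move=> rA; have fA : row_full A^T by rewrite /row_full mxrank_tr rA.
pose f := fullrankfun fA; have uB : colsub f A \in unitmx.
  by rewrite -unitmx_tr trmx_mxsub fullrowsub_unit.
exists (invmx (colsub f A) *m A); rewrite -(@cube_count_basis _ _ _ f).
  apply: eq_card => b; rewrite !inE eqmxMfull //.
  by rewrite row_full_unit unitmx_inv.
by rewrite -mulmx_colsub mulVmx.
Qed.

(** The subspace is the graph of the functionals; its identity block makes the parameters bits. *)
Lemma inHinf_functionals k r (N : 'I_r -> 'I_k -> int) :
  inHinf R k #|[set x | [forall j, bit (lc (N j) x)]]|.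
Proof.
exists (k + r)%N; split; first exact: leq_addr.
pose A : 'M[R]_(k, k + r) := row_mx 1%:M (\matrix_(i, j) (N j i)%:~R).
exists A; split.
  apply/eqP; rewrite -[_ == _]/(row_free A); apply/row_freeP.
  by exists (col_mx 1%:M 0); rewrite mul_row_col mulmx1 mulmx0 addr0.
rewrite (@cube_count_basis _ _ _ (@lshift k r)); last first.
  by apply/matrixP => i j; rewrite mxE row_mxEl.
apply: eq_card => x; rewrite !inE; apply/forallP/forallP => [xA j|xN j].
  have := xA (rshift k j); rewrite -rbit_int -lc_int; congr rbit.
  by apply: eq_bigr => i _; rewrite row_mxEr mxE.
case: (split_ordP j) => j' ->; last first.
  have := xN j'; rewrite -rbit_int -lc_int; congr rbit.
  by apply: eq_bigr => i _; rewrite row_mxEr mxE.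
rewrite /lc (bigD1 j') //= big1 => [|i ne].
  by rewrite row_mxEl mxE eqxx addr0 rbit_nat.
by rewrite row_mxEl mxE (negPf ne) mul0rn.
Qed.

(** If [d] and [d + L j i] can both be bits, then [L j i] is -1, 0 or 1; otherwise [card_half]
    contradicts largeness. *)
Lemma large_int k n (L : 'I_n -> 'I_k -> R) :
  (2 ^ k < #|[set x | [forall j, rbit (lc (L j) x)]]|.*2)%N ->
  exists2 N : 'I_n -> 'I_k -> int, (forall j i, N j i \in [:: -1; 0; 1]) &
    [set x | [forall j, rbit (lc (L j) x)]] = [set x | [forall j, bit (lc (N j) x)]].
Proof.
move=> large; have Lu j i : [|| L j i == -1, L j i == 0 | L j i == 1].
  apply: contraLR large => nu; rewrite -leqNgt.
  apply: (@leq_trans #|[set x | rbit (lc (L j) x)]|.*2).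
    by rewrite leq_double subset_leq_card //; apply/subsetP => x; rewrite !inE => /forallP.
  apply: (@card_half _ _ _ _ i) => d; apply: contra nu; rewrite /rbit.
  case/andP=> /orP[]/eqP->; rewrite ?add0r; first by case/orP=> ->; rewrite ?orbT.
  by case/orP=> /eqP/(canRL (addKr 1))->; rewrite ?addr0 ?addNr eqxx ?orbT.
exists (fun j i => if L j i == 0 then 0 else if L j i == 1 then 1 else -1).
  by move=> j i; case: ifP => _; rewrite !inE //; case: ifP.
apply/setP => x; rewrite !inE; apply: eq_forallb => j.
rewrite -rbit_int -lc_int; congr rbit; apply: eq_bigr => i _.
case: (L j i =P 0) => [->|/eqP n0] //; case: (L j i =P 1) => [->|/eqP n1] //.
by have := Lu j i; rewrite (negPf n0) (negPf n1) !orbF => /eqP->.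
Qed.
End Reparametrization.

(** * Systems attaining each size *)

Lemma card_prescribed k (c : pred 'I_k) (v : 'I_k -> bool) :
  #|[set x : {ffun 'I_k -> bool} | [forall i, c i ==> (x i == v i)]]| = (2 ^ #|[predC c]|)%N.
Proof.
pose F i : pred bool := if c i then pred1 (v i) else predT.
have -> : #|[set x : {ffun 'I_k -> bool} | [forall i, c i ==> (x i == v i)]]| = #|family F|.
  apply: eq_card => x; rewrite inE.
  by apply/forallP/familyP => h i; have := h i; rewrite /F; case: (c i).
rewrite card_family foldrE big_map.
rewrite big_enum -prod_nat_const [RHS]big_mkcond; apply: eq_big => // i _.
by rewrite inE /= /F unfold_in; case: (c i); rewrite /= ?card1 // -card_bool; apply: eq_card.
Qed.

Lemma star_count k i : (i < k.+1)%N ->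
  exists N : 'I_k.+1 -> 'I_k.+1 -> int,
    #|[set x | [forall j, bit (lc (N j) x)]]| = (2 ^ k + 2 ^ i)%N.
Proof.
move=> ik; (* x_max + x_j for i <= j < k *)
pose N (j j' : 'I_k.+1) : int :=
  if (i <= j < k)%N then (j' == ord_max)%:R + (j' == j)%:R else 0.
exists N; set V := [set x | _].
have NE j x : lc (N j) x = if (i <= j < k)%N then (x ord_max)%:R + (x j)%:R else 0.
  rewrite /lc /N; case: ifP => _; last by rewrite big1 // => j' _; rewrite mul0rn.
  have one (a : 'I_k.+1) : \sum_j' (j' == a)%:R *+ x j' = (x a)%:R :> int.
    rewrite (bigD1 a) //= eqxx big1 ?addr0 // => j' /negPf->; exact: mul0rn.
  by under eq_bigr => j' _ do rewrite mulrnDl; rewrite big_split /= !one.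
(* If [x ord_max] is 0, every constraint holds; if it is 1, the coordinates from [i] to [k - 1] must
   be 0 and the first [i] stay free. *)
rewrite -(cardsID [set x : {ffun 'I_k.+1 -> bool} | x ord_max] V) addnC; congr addn.
  rewrite (_ : _ :\: _ =
    [set x : {ffun 'I_k.+1 -> bool} | [forall j : 'I_k.+1, (j == ord_max) ==> (x j == false)]]).
    by rewrite (@card_prescribed _ (pred1 ord_max)) cardC1 card_ord.
  apply/setP => x; rewrite !inE; apply/andP/forallP => [[nx _] j|h].
    by apply/implyP => /eqP->; rewrite eqbF_neg.
  have := h ord_max; rewrite eqxx eqbF_neg => nx; split=> //.
  by apply/forallP => j; rewrite NE (negPf nx); case: ifP => _ //; case: (x j).
rewrite (_ : _ :&: _ =
    [set x : {ffun 'I_k.+1 -> bool} | [forall j : 'I_k.+1, (i <= j)%N ==> (x j == (j == ord_max))]]).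
  rewrite (@card_prescribed _ (fun j : 'I_k.+1 => i <= j)%N (fun j => j == ord_max)); congr expn.
  rewrite -sum1_card; under eq_bigl => j do rewrite !inE -ltnNge.
  by rewrite -(big_ord_widen _ (fun=> 1%N)) ?sum1_card ?card_ord // ltnW.
apply/setP => x; rewrite !inE; apply/andP/forallP => [[/forallP xN x1] j|h].
  apply/implyP => ij; have [->|ne] := eqVneq j ord_max; first by rewrite x1.
  have jk : (j < k)%N.
    by rewrite ltn_neqAle -ltnS ltn_ord andbT; apply: contra ne => /eqP e; apply/eqP/val_inj.
  by have := xN j; rewrite NE ij jk x1 /=; case: (x j).
have x1 : x ord_max by have := h ord_max; rewrite eqxx -ltnS ik => /eqP.
split=> //; apply/forallP => j; rewrite NE x1; case: ifP => // /andP[ij jk].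
have := h j; rewrite ij /= => /eqP->; case: eqP => // e.
by move: jk; rewrite e ltnn.
Qed.

Lemma exceptional_count k : exists N : 'I_1 -> 'I_(6 + k) -> int,
  #|[set x | [forall j, bit (lc (N j) x)]]| = (35 * 2 ^ k)%N.
Proof.
(* x0 + x1 + x2 + x3 - x4 - x5: 35 = 'C(7, 3) *)
pose g m : int := if (m < 4)%N then 1 else if (m < 6)%N then -1 else 0.
exists (fun _ i => g i).
have -> : #|[set x | [forall j : 'I_1, bit (lc (fun i : 'I_(6 + k) => g i) x)]]| =
          #|[set x | bit (0 + lc (fun i : 'I_(6 + k) => g i) x)]|.
  apply: eq_card => x; rewrite !inE add0r; apply/forallP/idP => [/(_ ord0)|] //.
rewrite card_cnt map_comp val_enum_ord iotaD map_cat.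
have -> : [seq g m | m <- iota (0 + 6) k] = nseq k 0.
  have /all_pred1P : all (pred1 0) [seq g m | m <- iota (0 + 6) k].
    apply/allP => z /mapP[m]; rewrite mem_iota /g => /andP[m6 _] ->.
    by case: ltnP => [|_]; [lia | case: ltnP => [|//]; lia].
  by rewrite size_map size_iota.
(* The zero coefficients give the factor [2 ^ k]. Complementing the two coordinates of coefficient
   -1, the others count six bits with sum 2 or 3: 15 + 20. *)
rewrite cnt_nz filter_cat count_cat filter_nseq count_nseq eqxx cats0 /=.
by rewrite mul1n.
Qed.

(** The fractions are 1/2 plus 1/2, 1/4, 1/8 or 1/16, and 35/64 = 1/2 + 1/32 + 1/64. *)
Lemma good_large k n : good k.+1 n -> (6 <= k.+1)%N ->
  (exists2 i : nat, (i < k.+1)%N & n = (2 ^ k + 2 ^ i)%N)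
  \/ n = (2 ^ k + 2 ^ (k.+1 - 5) + 2 ^ (k.+1 - 6))%N.
Proof.
move=> gn k6; have [d kE] : exists d, k = (5 + d)%N by exists (k - 5)%N; lia.
have e j : (j <= 6)%N -> ((5 + d).+1 - j = (6 - j) + d)%N by lia.
move: gn; rewrite /good kE /= !e // !expnD /= !inE.
case/or4P=> [/eqP->|/eqP->|/eqP->|/orP[]/eqP->]; last by right; rewrite mulnA -!mulnDl.
- by left; exists (5 + d)%N; rewrite // expnD !mulnA -mulnDl.
- by left; exists (4 + d)%N; [lia | rewrite expnD !mulnA -mulnDl].
- by left; exists (3 + d)%N; [lia | rewrite expnD !mulnA -mulnDl].
- by left; exists (2 + d)%N; [lia | rewrite expnD !mulnA -mulnDl].
Qed.

Theorem theorem1p1 (R : realType) (k : nat) (hk : (6 <= k)%N) (m : nat) :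
  inHinf_plus R k m <->
  ((exists2 i : nat, (i < k)%N & m = (2 ^ k.-1 + 2 ^ i)%N)
   \/ m = (2 ^ k.-1 + 2 ^ (k - 5) + 2 ^ (k - 6))%N).
Proof.
case: k hk => // k k6; split=> [[[n [_ [A [rA <-]]]]]|].
  have [L ->] := cube_count_rank rA; move=> large.
  have {}large : (2 ^ k.+1 < #|[set x | [forall j, rbit (lc (fun i => L i j) x)]]|.*2)%N.
    by rewrite expnS mul2n ltn_double.
  have [N Nu VE] := large_int large; rewrite VE in large *.
  have [|gn|] := classification Nu large; [by []| exact: good_large | by left].
case=> [[i ik ->]|->].
  split; last by rewrite -[X in (X < _)%N]addn0 ltn_add2l expn_gt0.
  by have [N <-] := star_count ik; exact: inHinf_functionals.
split; last by rewrite -addnA -[X in (X < _)%N]addn0 ltn_add2l addn_gt0 expn_gt0.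
have [d kE] : exists d, k.+1 = (6 + d)%N by exists (k.+1 - 6)%N; rewrite subnKC.
have [N NE] := exceptional_count d; rewrite kE; have := inHinf_functionals R N; rewrite NE.
congr (inHinf _ _ _).
rewrite addKn (_ : (6 + d).-1 = 5 + d)%N // (_ : 6 + d - 5 = 1 + d)%N; last lia.
by rewrite !expnD -mulnDl -mulSnr.
Qed.
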